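(* Let $D$ be a vf-safe delta-matroid with ground set $[n]$, let $(U,\Omega)$ be an $(n,3)$-carrier, let $\tau=(T_1,T_2,T_3)$ be a transversal $3$-tuple of $(U,\Omega)$, and let $\sigma:U\to[n]$ be a projection of $(U,\Omega)$. Then $$\operatorname{Orb}(D)=\{D_{Z_{D,\tau,\sigma},\tau',\sigma'}\mid \tau'\in\mathbb{T}_{(U,\Omega)},\ \sigma'\in\mathbb{P}_{(U,\Omega)}\}.$$
   Context: Set systems and the group action. A set system on $[n]=\{1,\dots,n\}$ is a pair $D=([n],\mathcal{F})$, $\mathcal{F}=\mathcal{F}(D)$ a collection of subsets of $[n]$ (feasible sets). It is a delta-matroid if $\mathcal{F}\ne\emptyset$ and for all $X,Y\in\mathcal{F}$ and $u\in X\triangle Y$ there is $v\in X\triangle Y$ (possibly $v=u$) with $X\triangle\{u,v\}\in\mathcal{F}$. For $i\in[n]$: $D\ast i=([n],\{X\triangle\{i\}:X\in\mathcal{F}\})$ and $D+i=([n],\mathcal{F}\triangle\{I\cup\{i\}:I\in\mathcal{F},i\notin I\})$. For fixed $i$ these satisfy the relations of $\mathcal{G}=\langle\ast,+\mid\ast^2,+^2,(\ast+)^3\rangle\cong S_3$; write $\overline{\ast}=+\ast+=\ast+\ast$. For a word $g=g_1\cdots g_k$, $D\,g\,i:=(\cdots(D\,g_k\,i)\cdots)g_1\,i$. Operations on distinct elements commute. For $\hat g=(g_1,\dots,g_n)\in\mathcal{G}^n$, $\hat g\cdot D$ is obtained by applying $g_i$ to $i$ for all $i$. For $I\subseteq[n]$,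 $D\overline{\ast}I$ applies $\overline{\ast}$ to every element of $I$; equivalently, $X\in\mathcal{F}(D\overline{\ast}I)$ iff $|\{Y\in\mathcal{F}(D): X\subseteq Y\subseteq X\cup I\}|$ is odd. $D$ is vf-safe if $\hat g\cdot D$ is a delta-matroid for all $\hat g\in\mathcal{G}^n$. For $\pi\in S_n$, $D_\pi=([n],\{\pi(I):I\in\mathcal{F}\})$. The semidirect product $\mathcal{G}^n\rtimes_\phi S_n$, with $(\hat g,\pi_1)(\hat h,\pi_2)=(\hat g\circ\hat h\pi_1^{-1},\pi_1\pi_2)$, $\circ$ componentwise, $(\hat h\pi^{-1})(i)=h_{\pi^{-1}(i)}$, acts on set systems by $(\hat g,\pi)D=\hat g\cdot D_\pi$; $\operatorname{Orb}(D)$ is the orbit of $D$. Carriers and lifts. An $(n,3)$-carrier is a pair $(U,\Omega)$ with $\Omega$ a partition of a finite set $U$ into $n$ classes (skew classes), each of size $3$. A transversal of $\Omega$ is a subset of $U$ meeting each class in exactly one element; $\mathcal{T}(\Omega)$ is the set of transversals. A transversal $3$-tuple is an ordered triple $(T_1,T_2,T_3)$ of mutually disjoint transversals with union $U$; $\mathbb{T}_{(U,\Omega)}$ is the set of them. A projection is a surjection $\sigma:U\to[n]$ with $\sigma(x)=\sigma(y)$ iff $x,y$ lie in the same skew class; $\mathbb{P}_{(U,\Omega)}$ is the set of them. For a vf-safe delta-matroid $D$ on $[n]$, $\tau=(T_1,T_2,T_3)$ and $\sigma$, let $$\mathcal{B}_{D,\tau,\sigma}=\{B\in\mathcal{T}(\Omega)\mid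 \sigma(B\cap T_2)\in\mathcal{F}(D\,\overline{\ast}\,\sigma(B\cap T_3))\}$$ and $Z_{D,\tau,\sigma}=(U,\Omega,\mathcal{B}_{D,\tau,\sigma}^* )$, where $\mathcal{B}^*=\{I\mid I\subseteq B\text{ for some }B\in\mathcal{B}\}$. This is a tight $3$-matroid with set of bases $\mathcal{B}_{D,\tau,\sigma}$. From $3$-matroids to delta-matroids. For a tight $3$-matroid $Z$ with carrier $(U,\Omega)$ and set of bases $\mathcal{B}_Z\subseteq\mathcal{T}(\Omega)$, $\tau=(T_1,T_2,T_3)\in\mathbb{T}_{(U,\Omega)}$ and $\sigma\in\mathbb{P}_{(U,\Omega)}$, $$D_{Z,\tau,\sigma}=([n],\{\sigma(X\cap T_2)\mid X\in\mathcal{B}_Z,\ X\subseteq T_1\cup T_2\}).$$ *)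

(* Defs.v *)
From HB Require Import structures.
From mathcomp Require Import all_boot all_fingroup all_solvable.

Set Implicit Arguments.
Unset Strict Implicit.
Unset Printing Implicit Defensive.

Local Open Scope group_scope.

Notation set_system n := {set {set 'I_n}}.

Definition symdiff (T : finType) (A B : {set T}) : {set T} :=
  (A :\: B) :|: (B :\: A).

Definition delta_matroid (n : nat) (D : set_system n) : Prop :=
  D != set0 /\
  forall X Y u, X \in D -> Y \in D -> u \in symdiff X Y ->
    exists2 v, v \in symdiff X Y & symdiff X [set u; v] \in D.

Inductive letter := Star | Plus.

Definition letter_act n (l : letter) (i : 'I_n) (D : set_system n) :
    set_system n :=
  match l with
  | Star => [set symdiff X [set i] | X in D]
  | Plus => symdiff D [set i |: I | I in D & i \notin I]
  end.

(* The last letter of a word acts first. *)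
Definition word_act n (w : seq letter) (i : 'I_n) (D : set_system n) :
    set_system n :=
  foldr (fun l E => letter_act l i E) D w.

Definition word_bar : seq letter := [:: Plus; Star; Plus].

Definition twist_bar n (D : set_system n) (I : {set 'I_n}) : set_system n :=
  foldr (word_act word_bar) D (enum I).

(* The group < *, + | *^2, +^2, ( * + )^3 > is realised as 'S_3 with two
   transpositions as generators; gen_pres below shows that 'S_3 has this
   presentation, and gact_word that the action of a group element does not
   depend on the word chosen to represent it. *)
Notation G3 := {perm 'I_3}.

Definition gen (l : letter) : G3 :=
  match l with
  | Star => tperm ord0 (@Ordinal 3 1 isT)
  | Plus => tperm (@Ordinal 3 1 isT) ord_max
  end.

Definition word_val (w : seq letter) : G3 := \prod_(l <- w) gen l.

Definition normal_words : seq (seq letter) :=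
  [:: [::]; [:: Star]; [:: Plus]; [:: Star; Plus]; [:: Plus; Star];
      [:: Plus; Star; Plus]].

Definition word_of (g : G3) : seq letter :=
  nth [::] normal_words (index g [seq word_val w | w <- normal_words]).

Definition gact n (g : G3) (i : 'I_n) (D : set_system n) : set_system n :=
  word_act (word_of g) i D.

(* The order in which the elements of 'I_n are treated is immaterial:
   see gactC. *)
Definition hat_act n (g : {ffun 'I_n -> G3}) (D : set_system n) :
    set_system n :=
  foldr (fun i E => gact (g i) i E) D (enum 'I_n).

Definition vf_safe n (D : set_system n) : Prop :=
  forall g : {ffun 'I_n -> G3}, delta_matroid (hat_act g D).

Definition perm_system n (p : 'S_n) (D : set_system n) : set_system n :=
  [set p @: I | I : {set 'I_n} in D].

Definition sdgroup (n : nat) : Type := ({ffun 'I_n -> G3} * 'S_n)%type.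

HB.instance Definition _ n := Finite.on (sdgroup n).

(* The product of permutations in the library applies its left factor first,
   so that the composite "x.2 after y.2" is y.2 * x.2. *)
Definition sd_mul n (x y : sdgroup n) : sdgroup n :=
  ([ffun i => x.1 i * y.1 (x.2^-1 i)], y.2 * x.2).

Definition sd_one n : sdgroup n := ([ffun=> 1], 1).

Definition sd_inv n (x : sdgroup n) : sdgroup n :=
  ([ffun i => (x.1 (x.2 i))^-1], x.2^-1).

Lemma sd_mulA n : associative (@sd_mul n).
Proof.
move=> x y z; congr (_, _); last by rewrite /= mulgA.
by apply/ffunP=> i; rewrite !ffunE /= invMg permM mulgA.
Qed.

Lemma sd_mul1 n : left_id (@sd_one n) (@sd_mul n).
Proof.
case=> g p; congr (_, _); last by rewrite /= mulg1.
by apply/ffunP=> i; rewrite !ffunE /= invg1 perm1 mul1g.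
Qed.

Lemma sd_mulV n : left_inverse (@sd_one n) (@sd_inv n) (@sd_mul n).
Proof.
case=> g p; congr (_, _); last by rewrite /= mulgV.
by apply/ffunP=> i; rewrite !ffunE /= invgK mulVg.
Qed.

HB.instance Definition _ n :=
  Finite_isGroup.Build (sdgroup n) (@sd_mulA n) (@sd_mul1 n) (@sd_mulV n).

Definition sd_act n (x : sdgroup n) (D : set_system n) : set_system n :=
  hat_act x.1 (perm_system x.2 D).

Definition Orb n (D : set_system n) : {set set_system n} :=
  [set sd_act x D | x : sdgroup n].

Definition carrier3 (U : finType) (n : nat) (Om : {set {set U}}) : bool :=
  [&& partition Om [set: U], #|Om| == n & [forall w in Om, #|w| == 3]].

Definition transversals (U : finType) (Om : {set {set U}}) : {set {set U}} :=
  [set T | is_transversal T Om [set: U]].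

Notation triple U := ({set U} * {set U} * {set U})%type.

Definition T1 (U : finType) (tau : triple U) : {set U} := tau.1.1.
Definition T2 (U : finType) (tau : triple U) : {set U} := tau.1.2.
Definition T3 (U : finType) (tau : triple U) : {set U} := tau.2.

Definition transversal_tuples (U : finType) (Om : {set {set U}}) :
    {set triple U} :=
  [set tau : triple U |
    [&& T1 tau \in transversals Om, T2 tau \in transversals Om,
        T3 tau \in transversals Om,
        [disjoint T1 tau & T2 tau], [disjoint T1 tau & T3 tau],
        [disjoint T2 tau & T3 tau]
      & T1 tau :|: T2 tau :|: T3 tau == [set: U]]].

Definition projections (U : finType) (n : nat) (Om : {set {set U}}) :
    {set {ffun U -> 'I_n}} :=
  [set s : {ffun U -> 'I_n} |
    [forall i, exists x, s x == i] &&
    [forall x, forall y,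
      (s x == s y) == [exists w in Om, (x \in w) && (y \in w)]]].

Record carrier_system (U : finType) := CarrierSystem {
  skew_classes : {set {set U}};
  indep : {set {set U}}
}.

Definition bases (U : finType) (Z : carrier_system U) : {set {set U}} :=
  [set B | maxset (fun I => I \in indep Z) B].

Definition subset_closure (U : finType) (B : {set {set U}}) : {set {set U}} :=
  [set I : {set U} | [exists X in B, I \subset X]].

Definition lift_bases (U : finType) n (Om : {set {set U}}) (D : set_system n)
    (tau : triple U) (s : {ffun U -> 'I_n}) : {set {set U}} :=
  [set B in transversals Om |
    s @: (B :&: T2 tau) \in twist_bar D (s @: (B :&: T3 tau))].

Definition Z_of (U : finType) n (Om : {set {set U}}) (D : set_system n)
    (tau : triple U) (s : {ffun U -> 'I_n}) : carrier_system U :=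
  CarrierSystem Om (subset_closure (lift_bases Om D tau s)).

Definition D_of (U : finType) n (Z : carrier_system U)
    (tau : triple U) (s : {ffun U -> 'I_n}) : set_system n :=
  [set s @: (X :&: T2 tau) | X in bases Z & X \subset T1 tau :|: T2 tau].

Lemma in_symdiff (T : finType) (A B : {set T}) x :
  (x \in symdiff A B) = (x \in A) (+) (x \in B).
Proof. by rewrite !inE; case: (x \in A); case: (x \in B). Qed.

Lemma symdiffK (T : finType) (A B : {set T}) : symdiff (symdiff A B) B = A.
Proof. by apply/setP=> x; rewrite !in_symdiff addbK. Qed.

Lemma symdiffAC (T : finType) (A B C : {set T}) :
  symdiff (symdiff A B) C = symdiff (symdiff A C) B.
Proof. by apply/setP=> x; rewrite !in_symdiff addbAC. Qed.

Lemma in_symdiff1 (T : finType) (A : {set T}) x :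
  (x \in symdiff A [set x]) = (x \notin A).
Proof. by rewrite in_symdiff set11 addbT. Qed.

Lemma in_symdiffN (T : finType) (A : {set T}) x y : x != y ->
  (x \in symdiff A [set y]) = (x \in A).
Proof. by move=> /negPf nxy; rewrite in_symdiff inE nxy addbF. Qed.

Lemma mem_star n (i : 'I_n) D X :
  (X \in letter_act Star i D) = (symdiff X [set i] \in D).
Proof.
apply/imsetP/idP=> [[Y DY ->]|DX]; first by rewrite symdiffK.
by exists (symdiff X [set i]); rewrite ?symdiffK.
Qed.

Lemma mem_plus n (i : 'I_n) D X :
  (X \in letter_act Plus i D) =
  (X \in D) (+) ((i \in X) && (symdiff X [set i] \in D)).
Proof.
rewrite in_symdiff; congr (_ (+) _).
apply/imsetP/andP=> [[Y]|[iX DX]].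
  rewrite inE => /andP[DY iY] ->; rewrite setU11; split=> //.
  suff ->: symdiff (i |: Y) [set i] = Y by [].
  apply/setP=> x; rewrite in_symdiff !inE.
  by case: eqP => [->|]; rewrite ?(negPf iY) //= addbF.
exists (symdiff X [set i]); first by rewrite inE DX in_symdiff1 iX.
apply/setP=> x; rewrite !(in_symdiff, inE).
by case: eqP => [->|]; rewrite ?iX ?addbF.
Qed.

Definition mem_letter := (mem_star, mem_plus).

Lemma letter_actC n l l' (i j : 'I_n) D : i != j ->
  letter_act l i (letter_act l' j D) = letter_act l' j (letter_act l i D).
Proof.
move=> nij; have nji: j != i by rewrite eq_sym.
apply/setP=> X; case: l; case: l';
  rewrite !mem_letter ?in_symdiffN // (symdiffAC X [set i]) //.
by case: (i \in X); case: (j \in X); rewrite ?addbF //= addbACA.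
Qed.

Lemma letter_actK n l (i : 'I_n) : involutive (letter_act l i).
Proof.
move=> D; apply/setP=> X; case: l; rewrite !mem_letter symdiffK // in_symdiff1.
by case: (i \in X); rewrite /= ?addbF // addbK.
Qed.

Lemma braid_act n (i : 'I_n) D :
  word_act [:: Star; Plus; Star] i D = word_act [:: Plus; Star; Plus] i D.
Proof.
apply/setP=> X; rewrite /= !mem_letter !symdiffK !in_symdiff1.
by case: (i \in X); case: (X \in D); case: (_ \in D).
Qed.

Local Arguments gen : simpl never.
Local Arguments letter_act : simpl never.

Lemma genK l : gen l * gen l = 1.
Proof. by case: l; rewrite tperm2. Qed.

Lemma permG3P (p q : G3) :
  p ord0 = q ord0 -> p (@Ordinal 3 1 isT) = q (@Ordinal 3 1 isT) ->
  p ord_max = q ord_max -> p = q.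
Proof.
move=> p0 p1 p2; apply/permP=> -[[|[|[|//]]] lti].
- by rewrite (_ : Ordinal lti = ord0) //; apply: val_inj.
- by rewrite (_ : Ordinal lti = Ordinal (isT : 1 < 3)) //; apply: val_inj.
- by rewrite (_ : Ordinal lti = ord_max) //; apply: val_inj.
Qed.

Definition gen_fun (l : letter) (k : nat) : nat :=
  match l, k with
  | Star, 0 => 1 | Star, 1 => 0 | Plus, 1 => 2 | Plus, 2 => 1 | _, _ => k
  end.

Lemma gen_funE l i : gen l i = gen_fun l i :> nat.
Proof. by case: l; case: i => [[|[|[|//]]] lti]; rewrite permE. Qed.

Lemma word_valE w i : word_val w i = foldl (fun k l => gen_fun l k) i w :> nat.
Proof.
rewrite /word_val; elim: w i => [|l w IH] i; first by rewrite big_nil perm1.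
by rewrite big_cons permM IH gen_funE.
Qed.

Lemma gen_braid : gen Star * (gen Plus * gen Star) =
                  gen Plus * (gen Star * gen Plus).
Proof. by apply: permG3P; apply: ord_inj; rewrite !permM !gen_funE. Qed.

Lemma normal_words_uniq : uniq [seq word_val w | w <- normal_words].
Proof.
pose h (p : G3) := [seq nat_of_ord (p i) | i <- [:: ord0; Ordinal (isT : 1 < 3); ord_max]].
apply: (@map_uniq _ _ h); rewrite -map_comp /h.
by rewrite /normal_words /= !word_valE.
Qed.


Lemma word_normal w : exists2 k, (k < 6)%N &
  let v := nth [::] normal_words k in word_val v = word_val w /\
  forall n (i : 'I_n) D, word_act v i D = word_act w i D.
Proof.
elim: w => [|l w [k ltk [vk ak]]]; first by exists 0.
have step v : word_val v = gen l * word_val (nth [::] normal_words k) ->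
    (forall n (i : 'I_n) D, word_act v i D =
      letter_act l i (word_act (nth [::] normal_words k) i D)) ->
    word_val v = word_val (l :: w) /\
    forall n (i : 'I_n) D, word_act v i D = word_act (l :: w) i D.
  move=> -> av; split; first by rewrite vk /word_val big_cons.
  by move=> n i D; rewrite av ak.
suff [k' ltk' [v' a']]: exists2 k', (k' < 6)%N &
    let v := nth [::] normal_words k' in
    word_val v = gen l * word_val (nth [::] normal_words k) /\
    (forall n (i : 'I_n) D, word_act v i D =
      letter_act l i (word_act (nth [::] normal_words k) i D)).
  by exists k' => //; apply: step.
move: l k ltk {vk ak step} => [] [|[|[|[|[|[|//]]]]]] _ /=;
  [exists 1%N | exists 0 | exists 3 | exists 2 | exists 5 | exists 4
  |exists 2 | exists 4 | exists 0 | exists 5 | exists 1%N | exists 3] => //;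
  rewrite /word_val !big_cons !big_nil ?mulg1;
  split=> [|n i D]; rewrite /word_act /= ?(mulgA, genK, mul1g, letter_actK) //.
- by rewrite -!mulgA gen_braid.
- by have /= := braid_act i D.
- by rewrite -!mulgA -gen_braid !mulgA genK mul1g.
- by have /= <- := braid_act i D; rewrite letter_actK.
Qed.

Lemma word_of_nth k : (k < 6)%N ->
  word_of (word_val (nth [::] normal_words k)) = nth [::] normal_words k.
Proof.
move=> ltk; rewrite /word_of -(nth_map _ (word_val [::])) //.
by rewrite index_uniq // normal_words_uniq.
Qed.

Lemma gact_word n w (i : 'I_n) D : gact (word_val w) i D = word_act w i D.
Proof.
by have [k ltk [vk ak]] := word_normal w; rewrite /gact -vk word_of_nth // ak.
Qed.

Lemma word_valK g : exists w, word_val w = g.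
Proof.
have sub : {subset map word_val normal_words <= enum {: G3}}.
  by move=> x _; rewrite mem_enum.
have [|_ /(_ g)] := uniq_min_size normal_words_uniq sub.
  by rewrite -cardE card_Sn.
rewrite mem_enum => /(nthP (word_val [::]))[k ltk <-].
by exists (nth [::] normal_words k); rewrite (nth_map [::]).
Qed.

Lemma gactM n g h (i : 'I_n) D : gact (g * h) i D = gact g i (gact h i D).
Proof.
have [v <-] := word_valK g; have [w <-] := word_valK h.
have <- : word_val (v ++ w) = word_val v * word_val w.
  by rewrite /word_val big_cat.
by rewrite !gact_word /word_act foldr_cat.
Qed.

Lemma gact1 n (i : 'I_n) D : gact 1 i D = D.
Proof. by have := gact_word [::] i D; rewrite /word_val big_nil. Qed.

Lemma gactC n g h (i j : 'I_n) D : i != j ->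
  gact g i (gact h j D) = gact h j (gact g i D).
Proof.
move=> nij; rewrite /gact; elim: (word_of g) => //= l v ->.
by elim: (word_of h) => //= l' w <-; rewrite letter_actC.
Qed.

Lemma twist_barE n (D : set_system n) I :
  twist_bar D I = hat_act [ffun i => if i \in I then word_val word_bar else 1] D.
Proof.
rewrite /twist_bar /hat_act [enum I]/(enum_mem _) /enum_mem -enumT.
elim: (enum 'I_n) => //= i s IH; rewrite ffunE -IH.
by case: ifP => iI /=; rewrite ?gact1 ?gact_word.
Qed.

Lemma gen_pres :
  [set: G3] \isog Grp (x : y : x ^+ 2, y ^+ 2, (x * y) ^+ 3).
Proof.
have gen2 l : #[gen l] = 2.
  apply: nt_prime_order; [by []|by rewrite expgS expg1 genK|].
  apply/eqP=> /permP/(_ (Ordinal (isT : 1 < 3)))/(congr1 val).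
  by rewrite /= perm1 gen_funE; case: l.
have genT : <<[set gen Star; gen Plus]>> = [set: G3].
  apply/eqP; rewrite -subTset; apply/subsetP=> g _.
  have [w <-] := word_valK g; apply: group_prod => l _.
  by apply: mem_gen; rewrite !inE; case: l; rewrite eqxx ?orbT.
have := involutions_gen_dihedral (gen2 Star) (gen2 Plus).
rewrite /= genT cardsT card_Sn => /(_ _)/= iso rT H.
rewrite (eq_homgr H (iso _)).
  exact: (@Grp'_dihedral 3).
by apply/eqP=> /permP/(_ ord0)/(congr1 val); rewrite /= !gen_funE.
Qed.

Lemma mem_perm_system n (p : 'S_n) D (X : {set 'I_n}) :
  (X \in perm_system p D) = (p^-1 @: X \in D).
Proof.
have K (q : 'S_n) (Y : {set 'I_n}) : q @: (q^-1 @: Y) = Y.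
  rewrite -imset_comp -[RHS]imset_id; apply: eq_imset => x /=.
  by rewrite permKV.
apply/imsetP/idP=> [[Y DY ->]|DX]; last by exists (p^-1 @: X); rewrite ?K.
by have := K p^-1 Y; rewrite invgK => ->.
Qed.

Lemma perm_system_letter n (p : 'S_n) l i D :
  perm_system p (letter_act l i D) = letter_act l (p i) (perm_system p D).
Proof.
apply/setP=> X; rewrite mem_perm_system.
have mi : (i \in p^-1 @: X) = (p i \in X).
  by rewrite -{1}(permK p i) mem_imset //; apply: perm_inj.
have si : symdiff (p^-1 @: X) [set i] = p^-1 @: (symdiff X [set p i]).
  apply/setP=> x; rewrite -(permK p x) !(in_symdiff, mem_imset); try exact: perm_inj.
  by rewrite !inE (inj_eq perm_inj) permK.
by case: l; rewrite !mem_letter !mem_perm_system si ?mi.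
Qed.

Lemma perm_system_gact n (p : 'S_n) g i D :
  perm_system p (gact g i D) = gact g (p i) (perm_system p D).
Proof.
by rewrite /gact; elim: (word_of g) => //= l w <-; apply: perm_system_letter.
Qed.

Lemma perm_system1 n (D : set_system n) : perm_system 1 D = D.
Proof.
apply/setP=> X; rewrite mem_perm_system invg1 (eq_imset _ (@perm1 _)).
by rewrite imset_id.
Qed.

Lemma perm_systemM n (p q : 'S_n) D :
  perm_system (q * p) D = perm_system p (perm_system q D).
Proof.
apply/setP=> X; rewrite !mem_perm_system invMg -imset_comp.
by congr (_ \in D); apply: eq_imset => x; rewrite permM.
Qed.

Lemma foldr_actC n (a : 'I_n -> set_system n -> set_system n) b s D :
  (forall i E, i \in s -> a i (b E) = b (a i E)) ->
  foldr a (b D) s = b (foldr a D s).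
Proof.
elim: s => //= i s IH ab; rewrite IH ?ab ?mem_head // => j E sj.
by rewrite ab // inE sj orbT.
Qed.

Lemma foldr_actM n (a b c : 'I_n -> set_system n -> set_system n) s D :
  (forall i E, c i E = a i (b i E)) ->
  (forall i j E, i != j -> a i (b j E) = b j (a i E)) ->
  uniq s -> foldr c D s = foldr a (foldr b D s) s.
Proof.
move=> cE ab; elim: s => //= i s IH /andP[si us].
rewrite IH // cE (foldr_actC (b := b i)) // => j E sj.
by rewrite ab //; apply: contraNneq si => <-.
Qed.

Lemma foldr_gact_perm n (g : 'I_n -> G3) s t D : uniq s -> perm_eq s t ->
  foldr (fun i => gact (g i) i) D s = foldr (fun i => gact (g i) i) D t.
Proof.
elim: s t => [|i s IH] t /=; first by rewrite perm_sym => _ /perm_nilP->.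
case/andP=> si us pst; have it : i \in t by rewrite -(perm_mem pst) mem_head.
case/splitPr: it pst => t1 t2 pst.
have {}pst : perm_eq s (t1 ++ t2).
  by rewrite -(perm_cons i) (perm_trans pst) // perm_catC /= perm_cons perm_catC.
rewrite (IH _ us pst) !foldr_cat /= foldr_actC // => j E t1j.
rewrite gactC //; apply: contraNneq si => <-.
by rewrite (perm_mem pst) mem_cat t1j.
Qed.

Lemma hat_act1 n (D : set_system n) : hat_act [ffun=> 1] D = D.
Proof.
by rewrite /hat_act; elim: (enum _) => //= i s ->; rewrite ffunE gact1.
Qed.

Lemma hat_actM n (g h : {ffun 'I_n -> G3}) D :
  hat_act [ffun i => g i * h i] D = hat_act g (hat_act h D).
Proof.
apply: foldr_actM (enum_uniq _) => [i E|i j E nij]; last exact: gactC.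
by rewrite ffunE gactM.
Qed.

Lemma perm_system_hat n (p : 'S_n) (g : {ffun 'I_n -> G3}) D :
  perm_system p (hat_act g D) =
  hat_act [ffun i => g (p^-1 i)] (perm_system p D).
Proof.
have pe : perm_eq (enum 'I_n) (map p (enum 'I_n)).
  apply: uniq_perm; rewrite ?(map_inj_uniq perm_inj) ?enum_uniq // => i.
  by rewrite mem_enum -{2}(permKV p i) mem_map ?mem_enum //; apply: perm_inj.
rewrite /hat_act.
rewrite [RHS](foldr_gact_perm _ _ (enum_uniq _) pe).
move: (enum _) => s; elim: s => //= i s IH.
by rewrite perm_system_gact IH ffunE permK.
Qed.

Lemma sd_act1 n (D : set_system n) : sd_act 1 D = D.
Proof. by rewrite /sd_act hat_act1 perm_system1. Qed.

Lemma sd_actM n (x y : sdgroup n) D :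
  sd_act (x * y) D = sd_act x (sd_act y D).
Proof.
rewrite [RHS]/sd_act [in RHS]/sd_act perm_system_hat.
have <- := hat_actM x.1 [ffun i => y.1 (x.2^-1 i)].
have <- : perm_system (y.2 * x.2) D = perm_system x.2 (perm_system y.2 D).
  exact: perm_systemM.
have -> : [ffun i => x.1 i * [ffun j => y.1 (x.2^-1 j)] i] = (x * y).1.
  by apply/ffunP=> i; rewrite !ffunE.
by [].
Qed.

Lemma bases_Z n (U : finType) (Om : {set {set U}}) (D : set_system n) tau s :
  bases (Z_of Om D tau s) = lift_bases Om D tau s.
Proof.
have cardT X : X \in lift_bases Om D tau s -> #|X| = #|Om|.
  rewrite !inE => /andP[/and3P[part _ trX] _].
  rewrite -sum1_card -(card_transversal (X := X) (P := Om) (D := [set: U])).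
    by rewrite sum1_card.
  by rewrite /is_transversal part subsetT.
apply/setP=> B; rewrite inE; apply/maxsetP/idP=> /= [[]|LB].
  rewrite inE => /existsP[X /andP[LX BX]] maxB.
  by rewrite -(maxB X) // inE; apply/existsP; exists X; rewrite LX subxx.
split=> [|I]; first by rewrite inE; apply/existsP; exists B; rewrite LB subxx.
rewrite inE => /existsP[X /andP[LX IX]] BI; apply/eqP.
rewrite eq_sym eqEcard BI (cardT _ LB) -(cardT _ LX).
exact: subset_leq_card.
Qed.

(* Main.v *)
(** Send a point [u] of the carrier to the pair formed by [sigma u] and the
    index in ['I_3] of the member of [tau] containing [u]; a transversal is then
    a function [b : 'I_n -> 'I_3].  The group ['S_3] acts so that the empty set
    is feasible in [hat_act g D] or not according to the function
    [i |-> g i 0] only, because the stabiliser of [0] is generated by [Plus],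
    which does not affect feasible sets avoiding [i].  The transversal [b] is a
    basis of the lift of [D] exactly when [set0 \in hat_act g D] for the [g] with
    [g i 0 = b i].  Passing from [(tau, sigma)] to [(tau', sigma')] changes
    coordinates by a permutation of ['I_n] and a permutation of ['I_3] for
    each index, that is, by an element of the semidirect product, and every such
    element occurs. *)

Require Import Defs.
From mathcomp Require Import all_boot all_fingroup.

Set Implicit Arguments.
Unset Strict Implicit.
Unset Printing Implicit Defensive.

Local Open Scope group_scope.

(** * Permutations of three points and the stabiliser of [o0] *)

Notation o0 := (@ord0 2).
Notation o1 := (@Ordinal 3 1 isT).
Notation o2 := (@ord_max 2).

Lemma I3P (P : 'I_3 -> Prop) : P o0 -> P o1 -> P o2 -> forall k, P k.
Proof.
move=> P0 P1 P2 [[|[|[|//]]] lt_k].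
- by rewrite (_ : Ordinal lt_k = o0) //; apply: val_inj.
- by rewrite (_ : Ordinal lt_k = o1) //; apply: val_inj.
- by rewrite (_ : Ordinal lt_k = o2) //; apply: val_inj.
Qed.

Lemma gen_ord l (i j : 'I_3) : gen_fun l i = j -> gen l i = j.
Proof. by move=> lij; apply: ord_inj; rewrite gen_funE. Qed.

Lemma stab_ord0 (g : G3) : g o0 = o0 -> g = 1 \/ g = gen Plus.
Proof.
move=> g0; have g_inj := @perm_inj _ g.
have := erefl (g o1); move: {2}(g o1); apply: I3P => g1.
- by have := g_inj _ _ (etrans g1 (esym g0)).
- have := erefl (g o2); move: {2}(g o2); apply: I3P => g2.
  + by have := g_inj _ _ (etrans g2 (esym g0)).
  + by have := g_inj _ _ (etrans g2 (esym g1)).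
  + by left; apply: permG3P; rewrite perm1.
- have := erefl (g o2); move: {2}(g o2); apply: I3P => g2.
  + by have := g_inj _ _ (etrans g2 (esym g0)).
  + by right; apply: permG3P; rewrite ?g0 ?g1 ?g2; apply/esym/gen_ord.
  + by have := g_inj _ _ (etrans g2 (esym g1)).
Qed.

Lemma gact_gen n l (i : 'I_n) D : Defs.gact (gen l) i D = letter_act l i D.
Proof. by have := Defs.gact_word [:: l] i D; rewrite /word_val big_seq1. Qed.

(** * Feasibility of the empty set under the group action *)

Section EmptySetFeasible.
Variable n : nat.
Implicit Types (D : set_system n) (X I : {set 'I_n}) (g h : {ffun 'I_n -> G3}).

Lemma set0_hat_act_stab g D : (forall i, g i o0 = o0) ->
  (set0 \in hat_act g D) = (set0 \in D).
Proof.
move=> g0; rewrite /hat_act; elim: (enum _) => //= i s <-.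
case: (stab_ord0 (g0 i)) => ->; rewrite ?Defs.gact1 //.
by rewrite gact_gen mem_plus inE addbF.
Qed.

(** Products apply their left factor first, so [g i * (h i)^-1] fixes [o0]; acting with it after [h]
    gives the action of [g] and does not change whether the empty set is feasible. *)
Lemma set0_hat_act g h D : (forall i, g i o0 = h i o0) ->
  (set0 \in hat_act g D) = (set0 \in hat_act h D).
Proof.
move=> gh; rewrite -[RHS](@set0_hat_act_stab [ffun i => g i * (h i)^-1]).
  rewrite -hat_actM; congr (_ \in hat_act _ D).
  by apply/ffunP=> i; rewrite !ffunE mulgKV.
by move=> i; rewrite ffunE permM gh permK.
Qed.

Definition star_on X : {ffun 'I_n -> G3} :=
  [ffun i => if i \in X then gen Star else 1].

Lemma mem_set0_star X D : (X \in D) = (set0 \in hat_act (star_on X) D).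
Proof.
rewrite /hat_act.
(* The induction twists only at the elements listed in [s]; uniqueness keeps an element from being
   toggled twice. *)
suff H s Y : uniq s ->
    (Y \in foldr (fun i => Defs.gact (star_on X i) i) D s) =
    (symdiff Y [set i in X | i \in s] \in D).
  rewrite H ?enum_uniq //; congr (_ \in D); apply/setP=> i.
  by rewrite in_symdiff !inE mem_enum andbT.
elim: s Y => [|i s IH] Y /=.
  by move=> _; congr (_ \in D); apply/setP=> i; rewrite in_symdiff !inE andbF
    addbF.
case/andP=> si us; rewrite ffunE; case: ifPn => iX.
  rewrite gact_gen mem_star IH //; congr (_ \in D); apply/setP=> j.
  rewrite !in_symdiff !inE; case: eqP => [->|_] /=; last by rewrite addbF.
  by rewrite iX (negPf si) addbF.
rewrite Defs.gact1 IH //; congr (_ \in D); apply/setP=> j.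
rewrite !in_symdiff !inE; case: eqP => [->|_] //=.
by rewrite (negPf iX).
Qed.

Lemma star_on0 X i : star_on X i o0 = if i \in X then o1 else o0.
Proof.
by rewrite ffunE; case: ifP; rewrite ?perm1 // => _; apply: gen_ord.
Qed.

(** Twisting by [star_on X] moves [X] to the empty set; by disjointness the combined group element
    at each index is then the star, the bar or 1, and these send [o0] to [o1], [o2] and [o0]. *)
Lemma mem_twist_bar X I D g :
  (forall i, g i o0 = if i \in X then o1 else if i \in I then o2 else o0) ->
  [disjoint X & I] ->
  (X \in twist_bar D I) = (set0 \in hat_act g D).
Proof.
move=> gE dXI; rewrite mem_set0_star twist_barE -hat_actM.
apply: set0_hat_act => i; rewrite !ffunE permM gE; case: (boolP (i \in X)) => iX.
  rewrite (disjointFr dXI iX) perm1.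
  exact: gen_ord.
rewrite perm1; case: ifP => _; last by rewrite perm1.
(* Along the letters of [word_bar] the point 0 goes to 0, then 1, then 2. *)
by apply: ord_inj; rewrite word_valE.
Qed.

Lemma mem_sd_act (x : sdgroup n) D X g :
  (forall i, g i o0 = x.1 (x.2 i) (if x.2 i \in X then o1 else o0)) ->
  (X \in sd_act x D) = (set0 \in hat_act g D).
Proof.
move=> gE; rewrite mem_set0_star -hat_actM.
transitivity (set0 \in perm_system x.2
  (hat_act [ffun i => star_on X (x.2 i) * x.1 (x.2 i)] D)).
  rewrite perm_system_hat; congr (_ \in hat_act _ _).
  by apply/ffunP=> i; rewrite !ffunE permKV.
rewrite mem_perm_system imset0; apply: set0_hat_act => i.
by rewrite ffunE permM star_on0 gE.
Qed.

End EmptySetFeasible.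

(** * Coordinates on the carrier *)

Definition coord (U : finType) (tau : triple U) (u : U) : 'I_3 :=
  if u \in T1 tau then o0 else if u \in T2 tau then o1 else o2.

Definition level_triple (U : finType) (c : U -> 'I_3) : triple U :=
  ([set u | c u == o0], [set u | c u == o1], [set u | c u == o2]).

Lemma coord_level (U : finType) (c : U -> 'I_3) : coord (level_triple c) =1 c.
Proof. by move=> u; rewrite /coord !inE; move: (c u); apply: I3P. Qed.

Lemma level_coord (U : finType) (Om : {set {set U}}) tau :
  tau \in transversal_tuples Om -> level_triple (coord tau) = tau.
Proof.
case: tau => [[A B] C]; rewrite inE /T1 /T2 /T3 /=.
case/and4P=> _ _ _ /and4P[dAB dAC dBC /eqP ABC].
rewrite /level_triple /coord /T1 /T2 /=.
by congr (_, _, _); apply/setP=> u; rewrite inE; have := in_setT u;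
  rewrite -ABC !inE; case: ifPn => uA /=;
  rewrite ?(disjointFr dAB uA) ?(disjointFr dAC uA) //;
  case: ifPn => uB /=; rewrite ?(disjointFr dBC uB) // => ->.
Qed.

Section Coordinates.
Variables (n : nat) (U : finType) (Om : {set {set U}}).
Hypothesis Om_carrier : carrier3 n Om.

Lemma projection_surj s i : s \in projections n Om -> exists u, s u = i.
Proof. by rewrite inE => /andP[/forallP/(_ i)/existsP[u /eqP]]; exists u. Qed.

Lemma projection_eq s s' u v :
  s \in projections n Om -> s' \in projections n Om ->
  (s u == s v) = (s' u == s' v).
Proof.
rewrite !inE => /andP[_ /forallP/(_ u)/forallP/(_ v)/eqP->].
by case/andP=> _ /forallP/(_ u)/forallP/(_ v)/eqP->.
Qed.

Lemma projection_comp s (p : 'S_n) :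
  s \in projections n Om -> [ffun u => p (s u)] \in projections n Om.
Proof.
move=> Ps; rewrite inE; apply/andP; split.
  apply/forallP=> i; have [u su] := projection_surj (p^-1 i) Ps.
  by apply/existsP; exists u; rewrite ffunE su permKV.
apply/forallP=> u; apply/forallP=> v; rewrite !ffunE (inj_eq perm_inj).
by move: Ps; rewrite inE => /andP[_ /forallP/(_ u)/forallP/(_ v)].
Qed.

Lemma classes_fibres s : s \in projections n Om ->
  Om = [set [set u | s u == i] | i : 'I_n].
Proof.
move=> Ps; have /and3P[Om_part _ _] := Om_carrier.
have /and3P[/eqP covO trivO nO] := Om_part.
have fibre u w : w \in Om -> u \in w -> w = [set v | s v == s u].
  move=> Ow wu; apply/setP=> v; rewrite inE.
  have := Ps; rewrite inE => /andP[_ /forallP/(_ v)/forallP/(_ u)/eqP->].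
  apply/idP/existsP => [wv|[w' /and3P[Ow' wv' wu']]].
    by exists w; rewrite Ow wv.
  by rewrite -(def_pblock trivO Ow wu) (def_pblock trivO Ow' wu').
apply/setP=> w; apply/idP/imsetP => [Ow|[i _ ->]].
  have /set0Pn[u wu] : w != set0 by apply: contraNneq nO => <-.
  by exists (s u) => //; apply: fibre.
have [u <-] := projection_surj i Ps.
have uO : u \in cover Om by rewrite covO inE.
by rewrite -(fibre u (pblock Om u)) ?pblock_mem // mem_pblock.
Qed.

(** [f] selects a point in each fibre of [s]; a single boolean equation encodes both existence and
    uniqueness of that point. *)
Lemma transversalP s (B : {set U}) : s \in projections n Om ->
  reflect (exists f : 'I_n -> U, forall i u, (u \in B) && (s u == i) = (u == f i))
          (B \in transversals Om).
Proof.
move=> Ps; have /and3P[Om_part _ _] := Om_carrier.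
rewrite inE /is_transversal Om_part subsetT /=.
apply: (iffP forall_inP) => [trB|[f fE] w].
  apply: (@fin_all_exists _ _
    (fun i y => forall u, (u \in B) && (s u == i) = (u == y))).
  move=> i; have /cards1P[y By] : #|B :&: [set u | s u == i]| == 1%N.
    by apply: trB; rewrite (classes_fibres Ps) imset_f.
  by exists y => u; have /setP/(_ u) := By; rewrite !inE.
rewrite (classes_fibres Ps) => /imsetP[i _ ->].
by apply/cards1P; exists (f i); apply/setP=> u; rewrite !inE fE.
Qed.

(** [e] is the inverse of the bijection sending [u] to the pair of [s u] and [coord tau u],
    described by its graph so that it serves for rewriting in both directions. *)
Lemma transversal_tupleP s tau : s \in projections n Om ->
  tau \in transversal_tuples Om ->
  exists e : 'I_n -> 'I_3 -> U, forall i k u,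
    (coord tau u == k) && (s u == i) = (u == e i k).
Proof.
move=> Ps Ttau; move: (Ttau); rewrite -{1}(level_coord Ttau) inE /T1 /T2 /T3 /= => /and4P[].
move=> /(transversalP _ Ps)[f0 E0] /(transversalP _ Ps)[f1 E1].
move=> /(transversalP _ Ps)[f2 E2] _.
exists (fun i k => if k == o0 then f0 i else if k == o1 then f1 i else f2 i).
by move=> i; apply: I3P => u /=; rewrite -?E0 -?E1 -?E2 inE.
Qed.

Lemma level_transversal_tuple s c (e : 'I_n -> 'I_3 -> U) :
  s \in projections n Om ->
  (forall i k u, (c u == k) && (s u == i) = (u == e i k)) ->
  level_triple c \in transversal_tuples Om.
Proof.
move=> Ps cE; have tr k : [set u | c u == k] \in transversals Om.
  by apply/(transversalP _ Ps); exists (e^~ k) => i u; rewrite inE cE.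
rewrite inE /T1 /T2 /T3 /= !tr /= -!setI_eq0.
by apply/and4P; split; apply/eqP/setP=> u; rewrite !inE; move: (c u); apply: I3P.
Qed.

(** * Lifted bases and recovered set systems in coordinates *)

Lemma mem_lift_bases s tau D (B : {set U}) (g : {ffun 'I_n -> G3}) :
  s \in projections n Om -> tau \in transversal_tuples Om ->
  B \in transversals Om ->
  (forall u, u \in B -> g (s u) o0 = coord tau u) ->
  (B \in lift_bases Om D tau s) = (set0 \in hat_act g D).
Proof.
move=> Ps Ttau trB gE; rewrite inE trB /=.
have /(transversalP _ Ps)[f fE] := trB.
have fB i : f i \in B /\ s (f i) = i.
  by have := fE i (f i); rewrite eqxx => /andP[-> /eqP].
have img (A : {set U}) i : (i \in s @: (B :&: A)) = (f i \in A).
  have [Bf sf] := fB i.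
  apply/imsetP/idP => [[u]|Af]; last by exists (f i); rewrite ?inE ?Bf.
  rewrite inE => /andP[Bu Au] iE; suff <- : u = f i by [].
  by apply/eqP; rewrite -fE Bu iE eqxx.
rewrite -(level_coord Ttau) /T2 /T3 /=; apply: mem_twist_bar => [i|].
  (* Writing [i] as [s (f i)] makes [gE] applicable: as [B] meets every fibre, [gE] determines all
     values of [g] at [o0]. *)
  have [Bf {1}<-] := fB i; rewrite gE // !img !inE.
  by move: (coord tau _); apply: I3P.
rewrite -setI_eq0; apply/eqP/setP=> i; rewrite in_setI !img !inE.
by move: (coord tau _); apply: I3P.
Qed.

(** A transversal inside the first two members of [tau'] is the indicator of a set [X] in the new
    coordinates. Applying [x.1] gives its old coordinates, which are exactly the values by which
    [mem_sd_act] tests [X]. *)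
Lemma D_of_Z s s' tau tau' D (x : sdgroup n) :
  s \in projections n Om -> s' \in projections n Om ->
  tau \in transversal_tuples Om -> tau' \in transversal_tuples Om ->
  (forall u, s' u = x.2 (s u)) ->
  (forall u, coord tau u = x.1 (s' u) (coord tau' u)) ->
  D_of (Z_of Om D tau s) tau' s' = sd_act x D.
Proof.
move=> Ps Ps' Ttau Ttau' sE cE.
have [e' e'E] := transversal_tupleP Ps' Ttau'.
have e'P j k : coord tau' (e' j k) = k /\ s' (e' j k) = j.
  by have := e'E j k (e' j k); rewrite eqxx => /andP[/eqP-> /eqP].
have tau'E := level_coord Ttau'.
have key (B : {set U}) (X : {set 'I_n}) : B \in transversals Om ->
    (forall u, u \in B -> coord tau' u = if s' u \in X then o1 else o0) ->
    (B \in lift_bases Om D tau s) = (X \in sd_act x D).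
  move=> trB BX.
  pose g : {ffun 'I_n -> G3} := [ffun i => star_on X (x.2 i) * x.1 (x.2 i)].
  have gE i : g i o0 = x.1 (x.2 i) (if x.2 i \in X then o1 else o0).
    by rewrite ffunE permM star_on0.
  rewrite (mem_sd_act D gE); apply: mem_lift_bases => // u Bu.
  by rewrite gE -sE -BX // cE.
apply/setP=> X; apply/imsetP/idP => [[B]|DX].
  rewrite inE bases_Z -{1 2}tau'E /T1 /T2 /= => /andP[LB BT] ->.
  have trB : B \in transversals Om by move: LB; rewrite inE => /andP[].
  rewrite -(key B) // => u Bu.
  have /(transversalP _ Ps')[f fE] := trB.
  have -> : (s' u \in s' @: (B :&: tau'.1.2)) = (coord tau' u == o1).
    have uf v : v \in B -> s' v = s' u -> v = u.
      move=> Bv svu; have /eqP-> : u == f (s' u) by rewrite -fE Bu eqxx.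
      by apply/eqP; rewrite -fE Bv svu eqxx.
    rewrite -{1}tau'E /=; apply/imsetP/idP => [[v]|cu].
      by rewrite !inE => /andP[Bv cv] /esym/(uf _ Bv) <-.
    by exists u; rewrite // !inE Bu.
  have := subsetP BT u Bu; rewrite !inE; move: (coord tau' u).
  by apply: I3P.
(* Conversely, the indicator of [X] is turned into a transversal. *)
pose b j := if j \in X then o1 else o0.
pose B := [set u | coord tau' u == b (s' u)].
have trB : B \in transversals Om.
  apply/(transversalP _ Ps'); exists (fun j => e' j (b j)) => j u.
  by rewrite inE -e'E; case: (s' u =P j) => [->|]; rewrite ?andbF.
have BE u : u \in B -> coord tau' u = if s' u \in X then o1 else o0.
  by rewrite inE => /eqP.
exists B.
  rewrite inE bases_Z (key B X) // DX -tau'E /T1 /T2 /=.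
  by apply/subsetP=> u /BE; rewrite !inE => ->; case: ifP.
rewrite -tau'E /T2 /=; apply/setP=> j; apply/idP/imsetP => [Xj|[u]].
  have [c1 s1] := e'P j o1; exists (e' j o1); last by rewrite s1.
  by rewrite !inE c1 s1 /b Xj.
by rewrite !inE => /andP[/eqP cu /eqP cu1] ->; move: cu; rewrite cu1 /b; case: ifP.
Qed.

(** * Changes of coordinates as elements of the semidirect product *)

Lemma coordinate_change s s' tau tau' :
  s \in projections n Om -> s' \in projections n Om ->
  tau \in transversal_tuples Om -> tau' \in transversal_tuples Om ->
  exists x : sdgroup n, (forall u, s' u = x.2 (s u)) /\
    (forall u, coord tau u = x.1 (s' u) (coord tau' u)).
Proof.
move=> Ps Ps' Ttau Ttau'.
have [e eE] := transversal_tupleP Ps Ttau.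
have [e' e'E] := transversal_tupleP Ps' Ttau'.
have eP j k : coord tau (e j k) = k /\ s (e j k) = j.
  by have := eE j k (e j k); rewrite eqxx => /andP[/eqP-> /eqP].
have e'P j k : coord tau' (e' j k) = k /\ s' (e' j k) = j.
  by have := e'E j k (e' j k); rewrite eqxx => /andP[/eqP-> /eqP].
(* Any level would serve in place of [o0], since [s'] is constant on the fibres of [s]. *)
have p_inj : injective (fun i => s' (e i o0)).
  move=> i j /eqP; rewrite (projection_eq _ _ Ps' Ps).
  by rewrite (eP i o0).2 (eP j o0).2 => /eqP.
have g_inj j : injective (fun k => coord tau (e' j k)).
  move=> k l ckl; suff ekl : e' j k = e' j l.
    by rewrite -(e'P j k).1 -(e'P j l).1 ekl.
  have /eqP skl : s (e' j k) == s (e' j l).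
    by rewrite (projection_eq _ _ Ps Ps') (e'P j k).2 (e'P j l).2.
  (* A point is the value of [e] at its own old coordinates, so points that agree in them
     coincide. *)
  apply/eqP; rewrite (_ : e' j l = e (s (e' j l)) (coord tau (e' j l))).
    by rewrite -eE ckl skl !eqxx.
  by apply/eqP; rewrite -eE !eqxx.
exists ([ffun j => perm (g_inj j)], perm p_inj); split=> u /=.
  by rewrite permE; apply/eqP; rewrite (projection_eq _ _ Ps' Ps) (eP _ _).2.
rewrite ffunE permE; congr (coord tau _).
by apply/eqP; rewrite -e'E !eqxx.
Qed.

Lemma coordinate_change_surj s tau (x : sdgroup n) :
  s \in projections n Om -> tau \in transversal_tuples Om ->
  exists s' tau', [/\ s' \in projections n Om, tau' \in transversal_tuples Om,
    forall u, s' u = x.2 (s u) &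
    forall u, coord tau u = x.1 (s' u) (coord tau' u)].
Proof.
move=> Ps Ttau; have [e eE] := transversal_tupleP Ps Ttau.
(* The required relation, solved for the coordinate of the new triple. *)
pose c u := (x.1 (x.2 (s u)))^-1 (coord tau u).
exists [ffun u => x.2 (s u)], (level_triple c); split.
- exact: projection_comp.
(* The point over [i] of new level [k] has old level [x.1 (x.2 i) k]. *)
- apply: (@level_transversal_tuple s c (fun i k => e i (x.1 (x.2 i) k)))
    => // i k u.
  rewrite -eE; case: (s u =P i) => [<-|]; rewrite ?andbF // !andbT.
  by rewrite /c (can2_eq (permKV _) (permK _)).
- by move=> u; rewrite ffunE.
- by move=> u; rewrite coord_level ffunE permKV.
Qed.

End Coordinates.

Theorem theorem5p7 (n : nat) (D : set_system n) (U : finType)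
    (Om : {set {set U}}) (tau : triple U) (sigma : {ffun U -> 'I_n})
    (D_delta : delta_matroid D) (D_vf_safe : vf_safe D)
    (Om_carrier : carrier3 n Om)
    (tau_tuple : tau \in transversal_tuples Om)
    (sigma_proj : sigma \in projections n Om) :
  Orb D = [set D_of (Z_of Om D tau sigma) tau' sigma'
             | tau' in transversal_tuples Om, sigma' in projections n Om].
Proof.
apply/setP=> E; apply/imsetP/imset2P => [[x _ ->]|[tau' s' Ttau' Ps' ->]].
  have [s' [tau' [Ps' Ttau' sE cE]]] :=
    coordinate_change_surj Om_carrier x sigma_proj tau_tuple.
  by exists tau' s' => //; rewrite (D_of_Z Om_carrier D (x := x)).
have [x [sE cE]] :=
  coordinate_change Om_carrier sigma_proj Ps' tau_tuple Ttau'.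
by exists x => //; apply: D_of_Z.
Qed.
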